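(* Let $d\geq 2$, let $K$ be a field closed with respect to taking all $d$-roots of elements, let $A=K[x_1,x_2,\ldots,x_n]$ be the polynomial algebra over $K$ in $n\geq 2$ variables $x_1,\ldots,x_n$, and let $A_0$ be the Veronese subalgebra of $A$ of degree $d$. Then every automorphism of $A_0$ is induced by (i.e. is the restriction to $A_0$ of) a $d$-graded automorphism of $K[x_1,x_2,\ldots,x_n]$.
   Context: $K$ is closed with respect to taking all $d$-roots of elements if for every $a\in K$ all $d$-th roots of $a$ lie in $K$ (i.e. $t^d-a$ splits into linear factors over $K$). For $0\le i\le d-1$ let $A_i$ be the $K$-linear span of all monomials of $A$ of total degree $kd+i$, $k\geq 0$; then $A=A_0\oplus A_1\oplus\cdots\oplus A_{d-1}$ is a $\mathbb{Z}/d\mathbb{Z}$-grading. The subalgebra $A_0$ is the Veronese subalgebra of $A$ of degree $d$. Automorphisms are $K$-algebra automorphisms. An automorphism $\phi$ of $A$ is called $d$-graded if $\phi(x_1),\ldots,\phi(x_n)\in A_1$; such $\phi$ restricts to an automorphism of $A_0$. *)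

(* Defs.v *)
From HB Require Import structures.
From mathcomp Require Import all_boot all_algebra.
From mathcomp Require Export mpoly.

Set Implicit Arguments.
Unset Strict Implicit.
Unset Printing Implicit Defensive.

Import GRing.Theory.
Local Open Scope ring_scope.

Definition closed_under_roots (d : nat) (K : fieldType) : Prop :=
  forall a : K, exists rs : seq K,
    'X^d - a%:P = \prod_(r <- rs) ('X - r%:P) :> {poly K}.

Section VeroneseGrading.
Variables (n : nat) (K : fieldType) (d : nat).

(* For i < d this is the component A_i, the span of the monomials of total
   degree k * d + i with k >= 0: see gradedP. *)
Definition graded (i : nat) : {pred {mpoly K[n]}} :=
  [pred p | all (fun m : 'X_{1..n} => (mdeg m %% d)%N == i) (msupp p)].

Lemma gradedE i p :
  reflect (forall m, m \in msupp p -> (mdeg m %% d)%N = i) (p \in graded i).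
Proof. by apply: (iffP allP) => h m /h /eqP. Qed.

Lemma gradedP i p : (i < d)%N ->
  p \in graded i <->
  exists s : seq (K * 'X_{1..n}),
    (forall cm, cm \in s -> exists k, mdeg cm.2 = (k * d + i)%N) /\
    p = \sum_(cm <- s) cm.1 *: 'X_[cm.2].
Proof.
move=> lt_id; split=> [/gradedE pi | [s [sP ->]]].
  exists [seq (p@_m, m) | m <- msupp p]; split.
    move=> _ /mapP[m mp ->]; exists (mdeg m %/ d)%N.
    by rewrite -(pi m mp) -divn_eq.
  by rewrite big_map {1}[p]mpolyE.
apply/gradedE => m; rewrite mcoeff_msupp raddf_sum /= big_seq => nz.
have [cm cms /eqP <-] : exists2 cm, cm \in s & cm.2 == m.
  apply/hasP; apply: contraNT nz => /hasPn h; rewrite big1 // => cm /h /negPf e.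
  by rewrite mcoeffZ mcoeffX e mulr0.
by have [k ->] := sP _ cms; rewrite modnMDl modn_small.
Qed.

Fact graded0_subring : subring_closed (graded 0).
Proof.
split=> [|p q /gradedE p0 /gradedE q0|p q /gradedE p0 /gradedE q0].
- by apply/gradedE => m; rewrite msupp1 inE => /eqP ->; rewrite mdeg0 mod0n.
- by apply/gradedE => m /msuppB_le; rewrite mem_cat => /orP[/p0|/q0].
apply/gradedE => m /msuppM_le /allpairsP[[m1 m2] /= [/p0 e1 /q0 e2 ->]].
by rewrite mdegD -modnDm e1 e2 mod0n.
Qed.

Fact graded0_scaler : GRing.scaler_closed (graded 0).
Proof.
by move=> c p /gradedE p0; apply/gradedE => m /msuppZ_le /p0.
Qed.

HB.instance Definition _ :=
  GRing.isSubringClosed.Build {mpoly K[n]} (graded 0) graded0_subring.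
HB.instance Definition _ :=
  GRing.isScaleClosed.Build K {mpoly K[n]} (graded 0) graded0_scaler.

Record veronese := Veronese { vval :> {mpoly K[n]}; _ : vval \in graded 0 }.

HB.instance Definition _ := [isSub for vval].
HB.instance Definition _ := [Choice of veronese by <:].
HB.instance Definition _ := [SubChoice_isSubComNzRing of veronese by <:].
HB.instance Definition _ := [SubZmodule_isSubLmodule of veronese by <:].
HB.instance Definition _ :=
  [SubNzRing_SubLmodule_isSubLalgebra of veronese by <:].
HB.instance Definition _ := [SubLalgebra_isSubAlgebra of veronese by <:].

(* Meant for automorphisms phi, where it says that phi is d-graded. *)
Definition d_graded (phi : {mpoly K[n]} -> {mpoly K[n]}) : Prop :=
  forall i : 'I_n, phi 'X_i \in graded 1.

End VeroneseGrading.

Definition is_automorphism (K : fieldType) (A : algType K)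
  (f : {lrmorphism A -> A}) : Prop := bijective f.

(* Main.v *)
From HB Require Import structures.
Require Import Defs.
From mathcomp Require Import all_boot all_order all_algebra.
From mathcomp Require Import ring.

(* Let [Y m] be the image of ['X_[m]] under [psi], for [d %| mdeg m].  Put
   [b i = Y (x_0^(d-1) x_i)]; as K[x_1..x_n] has gcds, [b i = g * u i] with [u]
   coprime.  The relations between monomials of degree [d] then give
   [Y m = h ^+ k * u^m] for [mdeg m = k * d].  By surjectivity of [psi], [h]
   divides ['X_i ^+ d] modulo constants for two different [i], so [h] is a
   constant, which a [d]-th root absorbs into [u]; hence [psi] is induced by
   [phi : 'X_i |-> u i].  Lifting the inverse of [psi] likewise to [phi'], the
   composite of [phi] and [phi'] is the identity on the Veronese subalgebra,
   which forces it to be a scaling, so [phi] is bijective.  Coprimality (and not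
   roots of unity, which are lacking when the characteristic divides [d]) puts
   all the [u i] in one graded component [j], and those of [phi'] in some [j'];
   comparing with the degree one of the scaling gives [j * j' = 1 %[mod d]] and
   [j * j' <= 1], hence [j = 1]. *)

Set Implicit Arguments.
Unset Strict Implicit.
Unset Printing Implicit Defensive.

Import Order.TTheory GRing.Theory.
Local Open Scope ring_scope.

(** * Divisibility and gcds in integral domains *)

Section Divisibility.
Variable R : idomainType.
Implicit Types a b c e g w x : R.

Definition divides w x := exists y, x = y * w.

Lemma divides0 w : divides w 0.
Proof. by exists 0; rewrite mul0r. Qed.

Lemma dividesxx w : divides w w.
Proof. by exists 1; rewrite mul1r. Qed.

Lemma dividesD w x y : divides w x -> divides w y -> divides w (x + y).
Proof. by move=> [s ->] [t ->]; exists (s + t); rewrite mulrDl. Qed.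

Lemma divides_mull w x y : divides w y -> divides w (x * y).
Proof. by move=> [t ->]; exists (x * t); rewrite mulrA. Qed.

Lemma divides_mulr w x y : divides w x -> divides w (x * y).
Proof. by rewrite mulrC; apply: divides_mull. Qed.

Lemma dividesB w x y : divides w x -> divides w y -> divides w (x - y).
Proof. by move=> [s ->] [t ->]; exists (s - t); rewrite mulrBl. Qed.

Lemma divides_trans w x y : divides w x -> divides x y -> divides w y.
Proof. by move=> wx [t ->]; apply: divides_mull. Qed.

Lemma divides_mul2l a w x : a != 0 -> divides (a * w) (a * x) <-> divides w x.
Proof.
move=> nza; split=> [] [y e]; exists y; last by rewrite e mulrCA.
by apply: (mulfI nza); rewrite e mulrCA.
Qed.

(* Testing common divisors after scaling by an arbitrary [c] makes gcds
   compatible with products without any appeal to factorisations. *)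
Definition is_gcd (I : Type) (b : I -> R) g :=
  forall w c, (forall i, divides w (c * b i)) <-> divides w (c * g).

Definition gcd_domain := forall b : bool -> R, exists g, is_gcd b g.

Lemma is_gcd_dvd (I : Type) (b : I -> R) g i : is_gcd b g -> divides g (b i).
Proof.
move=> /(_ g 1)[_ h]; rewrite -[b i]mul1r; apply: h.
by rewrite mul1r; apply: dividesxx.
Qed.

(** A gcd of [a :: s] is a binary gcd of [a] and a gcd of [s], since the scaled test for the latter
    unfolds into the tests for the entries of [s]. The default entries 0 pass every test. *)
Lemma is_gcd_seq (s : seq R) : gcd_domain ->
  exists g, is_gcd (fun i : nat => s`_i) g.
Proof.
move=> gcdR; elim: s => [|a s [g gs]].
  exists 0 => w c; split=> _; first by rewrite mulr0; apply: divides0.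
  by move=> i; rewrite nth_nil mulr0; apply: divides0.
have [h gh] := gcdR (fun t => if t then a else g); exists h => w c.
split=> [ws | /gh wh].
  apply/gh => -[]; first exact: (ws 0%N).
  by apply/gs => i; apply: (ws i.+1).
case=> [|i] /=; first exact: (wh true).
by move: i; apply/gs; apply: (wh false).
Qed.

(** Testing [g * w] against [b] amounts to testing [w] against the cofactors [u], because the
    nonzero [g] cancels. *)
Lemma is_gcd_coprime n (b : 'I_n -> R) : gcd_domain -> (exists i, b i != 0) ->
  exists g (u : 'I_n -> R),
    [/\ g != 0, forall i, b i = g * u i & is_gcd u 1].
Proof.
move=> gcdR [i0 nz]; have [g gb] := is_gcd_seq (codom b) gcdR.
have {}gb : is_gcd b g.
  move=> w c; split=> [wb|/gb wg i]; last first.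
    by have := wg (enum_rank i); rewrite nth_codom enum_rankK.
  apply/gb => i; have [lti|gei] := ltnP i (size (codom b)).
    by have /codomP[j ->] := mem_nth 0 lti; apply: wb.
  by rewrite nth_default // mulr0; apply: divides0.
have /fin_all_exists[u uE] : forall i, exists y, b i = y * g.
  by move=> i; apply: is_gcd_dvd.
have nzg : g != 0 by apply: contraNneq nz => g0; rewrite uE g0 mulr0.
exists g, u; split=> // [i|w c]; first by rewrite uE mulrC.
rewrite mulr1 -(divides_mul2l _ _ nzg) [g * c]mulrC.
split=> [wu|/gb wu i].
  apply/gb => i; rewrite uE mulrA [_ * g]mulrC.
  by apply/(divides_mul2l _ _ nzg); apply: wu.
by apply/(divides_mul2l _ _ nzg); rewrite mulrCA [g * u i]mulrC -uE; apply: wu.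
Qed.

End Divisibility.

(** * Gauss's lemma *)

Section Gauss.
Import Pdiv.Idomain.
Variable R : idomainType.
Implicit Types (a b c e g w x : R) (p q r : {poly R}).

Lemma divides_polyC w p : divides w%:P p <-> forall i, divides w p`_i.
Proof.
split=> [[q ->] i|wp]; first by rewrite coefMC; exists q`_i.
have /fin_all_exists[u uE] : forall i : 'I_(size p), exists y, p`_i = y * w.
  by move=> i; apply: wp.
exists (\poly_(i < size p) (if insub i is Some j then u j else 0)).
apply/polyP => i; rewrite coefMC coef_poly; case: ifP => [lti|/negbT].
  by rewrite insubT /= -uE.
by rewrite -leqNgt => ?; rewrite mul0r nth_default.
Qed.

Lemma divides_CC w a : divides w a -> divides w%:P a%:P.
Proof. by move=> [y ->]; exists y%:P; rewrite polyCM. Qed.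

(** By [divides_polyC], [g] is a gcd of the coefficients of [p] in the scaled sense of [is_gcd];
    content 1 means primitive. *)
Definition content p g :=
  forall w c, divides w%:P (c%:P * p) <-> divides w (c * g).

Lemma content_exists p : gcd_domain R -> exists g, content p g.
Proof.
move=> /(is_gcd_seq p)[g gp]; exists g => w c.
rewrite divides_polyC -gp.
by split=> wp i; have := wp i; rewrite coefCM.
Qed.

Lemma content00 : content 0 0.
Proof. by move=> w c; rewrite !mulr0; split=> _; apply: divides0. Qed.

Lemma content0 g : content 0 g -> g = 0.
Proof.
move=> /(_ 0 1)[h _]; move: h; rewrite !mul1r => -[|y ->]; last exact: mulr0.
exact: divides0.
Qed.

Lemma content_neq0 p g : content p g -> p != 0 -> g != 0.
Proof.
move=> cp; apply: contraNneq => g0; move: (cp 0 1); rewrite g0 !mul1r.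
by case=> _ []; [apply: divides0 | move=> y ->; rewrite mulr0].
Qed.

Lemma contentM a p g : content p g -> content (a%:P * p) (a * g).
Proof. by move=> cp w c; rewrite !mulrA -polyCM; apply: cp. Qed.

Lemma content_cancel a p g : a != 0 -> content (a%:P * p) (a * g) -> content p g.
Proof.
move=> nza cp w c; have nzaP : a%:P != 0 :> {poly R} by rewrite polyC_eq0.
rewrite -(divides_mul2l _ _ nza) -(divides_mul2l _ _ nzaP) -polyCM.
by rewrite ![_ * (c * _)]mulrCA [_ * (c%:P * _)]mulrCA; apply: cp.
Qed.

Lemma content_dvd p g : content p g -> divides g%:P p.
Proof. by move=> /(_ g 1)[_]; rewrite !mul1r; apply; apply: dividesxx. Qed.

Lemma content_unique p g h : content p g -> content p h -> divides g h.
Proof.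
by move=> cg /(_ g 1); rewrite !mul1r => -[+ _]; apply; apply: content_dvd.
Qed.

Lemma primitive_part p g : content p g -> p != 0 ->
  exists q, [/\ p = g%:P * q, content q 1 & size q = size p].
Proof.
move=> cp nzp; have nzg := content_neq0 cp nzp.
have [q pE] := content_dvd cp; rewrite mulrC in pE.
exists q; split=> //; last by rewrite pE mul_polyC size_scale.
by apply: (content_cancel nzg); rewrite -pE mulr1.
Qed.

Lemma size_sub_lead p : p != 0 ->
  (size (p - (lead_coef p)%:P * 'X^((size p).-1))%R < size p)%N.
Proof.
move=> nzp; have sp : (0 < size p)%N by rewrite lt0n size_poly_eq0.
rewrite -[X in (_ < X)%N](prednK sp) ltnS; apply/leq_sizeP => j lej.
rewrite coefB coefCM coefXn; have [->|ne] := eqVneq j (size p).-1.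
  by rewrite mulr1 lead_coefE subrr.
rewrite mulr0 subr0 nth_default // -(prednK sp).
by rewrite ltn_neqAle eq_sym ne.
Qed.

(* [w] divides [c * lc(p) * lc(q)]; discarding the leading term of [q], then that
   of [p], induction removes the factors [lc(q)] and [lc(p)] in turn. *)
Lemma Gauss_primitive p q w c : gcd_domain R -> content p 1 -> content q 1 ->
  divides w%:P (c%:P * (p * q)) -> divides w c.
Proof.
move=> gcdR; have [n le_n] := ubnP (size p + size q).
elim: n => // n IH in p q c le_n *.
(* The induction hypothesis without primitivity of the second factor: the content [h] of [r] is
   moved into the scalar, and [ch] brings it back. *)
have IHr p1 r e : content p1 1 -> (size p1 + size r < n)%N ->
    divides w%:P (e%:P * (p1 * r)) -> divides w%:P (e%:P * r).
  move=> cp1 lt_n; have [->|nzr] := eqVneq r 0.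
    by rewrite !mulr0 => _; apply: divides0.
  have [h ch] := content_exists r gcdR.
  have [r1 [rE cr1 sr1]] := primitive_part ch nzr.
  move=> wr; apply/ch; apply: (IH p1 r1) => //; first by rewrite sr1.
  by rewrite polyCM -!mulrA [h%:P * _]mulrCA -rE.
move=> cp cq wpq.
have [p0|nzp] := eqVneq p 0.
  move: (cp w c); rewrite p0 !(mulr1, mulr0) => -[+ _]; apply.
  exact: divides0.
have [q0|nzq] := eqVneq q 0.
  move: (cq w c); rewrite q0 !(mulr1, mulr0) => -[+ _]; apply.
  exact: divides0.
have wab : divides w (c * lead_coef p * lead_coef q).
  rewrite -mulrA -lead_coefM lead_coefE; move/divides_polyC: wpq.
  by move=> /(_ (size (p * q)).-1); rewrite coefCM.
have wa : divides w (c * lead_coef p).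
  rewrite -[_ * _]mulr1; apply/cq.
  rewrite -[q](subrK ((lead_coef q)%:P * 'X^((size q).-1))) mulrDr.
  apply: dividesD; last by rewrite mulrA -polyCM; apply/divides_mulr/divides_CC.
  apply: (IHr p) => //.
    by apply: leq_trans (le_n : (_ <= n)%N); rewrite ltn_add2l size_sub_lead.
  have -> : (c * lead_coef p)%:P * (p * (q - (lead_coef q)%:P * 'X^((size q).-1)))
      = (lead_coef p)%:P * (c%:P * (p * q))
        - p * 'X^((size q).-1) * (c * lead_coef p * lead_coef q)%:P.
    by rewrite !polyCM; ring.
  by apply: dividesB; apply: divides_mull => //; apply: divides_CC.
rewrite -[c]mulr1; apply/cp.
rewrite -[p](subrK ((lead_coef p)%:P * 'X^((size p).-1))) mulrDr.
apply: dividesD; last by rewrite mulrA -polyCM; apply/divides_mulr/divides_CC.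
apply: (IHr q) => //.
  by apply: leq_trans (le_n : (_ <= n)%N); rewrite addnC ltn_add2r size_sub_lead.
have -> : c%:P * (q * (p - (lead_coef p)%:P * 'X^((size p).-1)))
    = c%:P * (p * q) - q * 'X^((size p).-1) * (c * lead_coef p)%:P.
  by rewrite !polyCM; ring.
by apply: dividesB => //; apply/divides_mull/divides_CC.
Qed.

(** Splitting each factor into content and primitive part reduces the claim to [Gauss_primitive]. *)
Lemma Gauss_content p q g h : gcd_domain R ->
  content p g -> content q h -> content (p * q) (g * h).
Proof.
move=> gcdR cp cq.
have [p0|nzp] := eqVneq p 0.
  by move: cp; rewrite p0 mul0r => /content0 ->; rewrite mul0r; apply: content00.
have [q0|nzq] := eqVneq q 0.
  by move: cq; rewrite q0 mulr0 => /content0 ->; rewrite mulr0; apply: content00.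
have [p1 [pE cp1 _]] := primitive_part cp nzp.
have [q1 [qE cq1 _]] := primitive_part cq nzq.
have pqE c : c%:P * (p * q) = (c * (g * h))%:P * (p1 * q1).
  by rewrite {1}pE {1}qE !polyCM; ring.
move=> w c; rewrite pqE; split=> [|[y ->]]; first exact: Gauss_primitive.
by exists (y%:P * (p1 * q1)); rewrite polyCM mulrAC.
Qed.

(** Here [%|] is divisibility up to a nonzero scalar, that is, over the fraction field; the contents
    decide whether the scalar can be removed. *)
Lemma divides_content p q g h : gcd_domain R -> content p g -> content q h ->
  divides p q <-> divides g h /\ p %| q.
Proof.
move=> gcdR cp cq; split=> [[r qE]|[gh pq]].
  have [e cr] := content_exists r gcdR; rewrite qE dvdp_mull ?dvdpp //.
  split=> //; apply: (divides_trans _ (content_unique _ cq)).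
    by apply: divides_mull (dividesxx _).
  by rewrite qE; apply: Gauss_content.
have [q0|nzq] := eqVneq q 0; first by rewrite q0; apply: divides0.
have nzp : p != 0 by apply: dvdpN0 pq nzq.
have [p1 [pE cp1 _]] := primitive_part cp nzp.
have [q1 [qE cq1 _]] := primitive_part cq nzq.
have /dvdpP[[l r] /= nzl lE] : p1 %| q1.
  move: pq; rewrite {1}pE {1}qE !mul_polyC.
  by rewrite dvdpZr ?dvdpZl // ?(content_neq0 cp) ?(content_neq0 cq).
have [e cr] := content_exists r gcdR.
(* The scalar [l] divides [r * p1], whose content is that of [r] because [p1] is primitive. *)
have le : divides l e.
  have := Gauss_content gcdR cr cp1; rewrite -lE mulr1 => /(_ l 1).
  rewrite !mul1r => -[h1 _]; apply: h1; rewrite -mul_polyC.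
  by apply: divides_mulr; apply: dividesxx.
have /content_dvd re := cr.
have [s sE] : divides l%:P r.
  by apply: divides_trans re; have [t ->] := le; exists t%:P; rewrite polyCM.
have q1E : q1 = s * p1.
  apply: (@mulfI _ l%:P); first by rewrite polyC_eq0.
  by rewrite mul_polyC lE sE; ring.
have [t tE] := gh; exists (t%:P * s).
by rewrite qE q1E pE tE polyCM; ring.
Qed.

Theorem gcd_domain_poly : gcd_domain R -> gcd_domain {poly R}.
Proof.
move=> gcdR f.
have [gt ct] := content_exists (f true) gcdR.
have [gf cf] := content_exists (f false) gcdR.
have [e ge] := gcdR (fun t => if t then gt else gf).
(* [G0] is a gcd only up to scalars. Giving its primitive part the content [e] keeps its divisors
   for [%|] and yields a genuine gcd. *)
pose G0 := gcdp (f true) (f false).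
have [G [cG GE]] :
    exists G, content G e /\ (forall w : {poly R}, w %| G = (w %| G0)).
  have [G00|nzG0] := eqVneq G0 0.
    exists 0; split; last by move=> w; rewrite G00.
    move: G00 => /eqP; rewrite gcdp_eq0 => /andP[/eqP ft0 /eqP ff0].
    move: ct cf; rewrite ft0 ff0 => /content0 gt0 /content0 gf0.
    have -> : e = 0.
      have : divides 0 (1 * e).
        by apply/ge => -[]; rewrite ?gt0 ?gf0 mulr0; apply: divides0.
      by rewrite mul1r => -[y ->]; rewrite mulr0.
    exact: content00.
  have [g cg] := content_exists G0 gcdR.
  have [G1 [G1E cG1 _]] := primitive_part cg nzG0.
  exists (e%:P * G1); split.
    by rewrite -[X in content _ X]mulr1; apply: contentM.
  have nze : e != 0.
    apply: contraNneq nzG0 => e0; rewrite gcdp_eq0.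
    have dv t : divides 0 (if t then gt else gf).
      by rewrite -e0; apply: is_gcd_dvd ge.
    have gt0 : gt = 0 by have [y ->] := dv true; rewrite mulr0.
    have gf0 : gf = 0 by have [y ->] := dv false; rewrite mulr0.
    have [y ->] := content_dvd ct; have [z ->] := content_dvd cf.
    by rewrite gt0 gf0 polyC0 !mulr0 eqxx.
  by move=> w; rewrite G1E !mul_polyC !dvdpZr // (content_neq0 cg).
exists G => w c.
have [[ow cw] [oc cc]] := (content_exists w gcdR, content_exists c gcdR).
have cM p g := @Gauss_content c p oc g gcdR cc.
have dG : w %| c * G = (w %| c * f true) && (w %| c * f false).
  rewrite -dvdp_gcd -(eqp_dvdr _ (mulp_gcdr _ _ _)).
  have : G %= G0 by rewrite /eqp -GE dvdpp GE dvdpp.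
  by move/(eqp_mull c)/eqp_dvdr => ->.
(* Divisibility by [w] now splits into a condition on contents, governed by [e], and one for [%|],
   governed by [gcdp]. *)
rewrite (divides_content gcdR cw (cM _ _ cG)) dG -ge.
split=> [h|[h /andP[wt wf]] []]; last 2 first.
- by apply/(divides_content gcdR cw (cM _ _ ct)); split=> //; apply: (h true).
- by apply/(divides_content gcdR cw (cM _ _ cf)); split=> //; apply: (h false).
have /(divides_content gcdR cw (cM _ _ ct))[ht ->] := h true.
have /(divides_content gcdR cw (cM _ _ cf))[hf ->] := h false.
by split=> // -[].
Qed.

End Gauss.

(** * Gcds over a field and their transfer along ring isomorphisms *)

Lemma gcd_domain_field (K : fieldType) : gcd_domain K.
Proof.
move=> b; have div1 (x w : K) : w != 0 -> divides w x.
  by move=> nzw; exists (x / w); rewrite divfK.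
exists (if (b true == 0) && (b false == 0) then 0 else 1) => w c.
have [->|nzw] := eqVneq w 0; last by split=> *; apply: div1.
have d0 (x : K) : divides 0 x <-> x = 0.
  by split=> [[y ->]|->]; [rewrite mulr0 | apply: divides0].
split=> [h|].
  have := (h true, h false); case: ifP => [_|nb] [].
    by rewrite mulr0 => *; apply: divides0.
  move=> /d0/eqP + /d0/eqP; rewrite !mulf_eq0.
  case: (c =P 0) => [-> _ _|_ /= bt bf]; first by rewrite mul0r; apply: divides0.
  by rewrite bt bf in nb.
case: ifP => [/andP[/eqP bt /eqP bf] _ []|_ /d0/eqP].
- by rewrite bt mulr0; apply: divides0.
- by rewrite bf mulr0; apply: divides0.
by rewrite mulr1 => /eqP -> i; rewrite mul0r; apply: divides0.
Qed.

Lemma gcd_domain_iso (R S : idomainType) (f : {rmorphism R -> S})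
    (g : S -> R) : cancel f g -> cancel g f -> gcd_domain S -> gcd_domain R.
Proof.
move=> fK gK gcdS b; have [h hP] := gcdS (f \o b).
have fdiv w x : divides w x <-> divides (f w) (f x).
  split=> [] [y e]; first by exists (f y); rewrite e rmorphM.
  by exists (g y); apply: (can_inj fK); rewrite rmorphM gK e.
exists (g h) => w c; rewrite fdiv rmorphM gK -hP.
by split=> wb t; have := wb t; rewrite fdiv rmorphM.
Qed.

(** * Polynomials in [n.+1] variables as univariate polynomials over those in [n] *)

Section MPoly.
Variables (n : nat) (R : comNzRingType).

(** The inverse of [muni]: the univariate indeterminate becomes the last variable again. *)
Definition unmuni (q : {poly {mpoly R[n]}}) : {mpoly R[n.+1]} :=
  (map_poly (@mwiden n R) q).['X_ord_max].

Lemma muniX (m : 'X_{1..n.+1}) :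
  muni 'X_[R, m] =
    'X_[[multinom (m (widen_ord (leqnSn n) i)) | i < n]] *: 'X^(m ord_max).
Proof. by rewrite muniE msuppX big_seq1 mcoeffX eqxx scale1r. Qed.

Lemma mnm_widenD (m : 'X_{1..n.+1}) :
  (mnmwiden [multinom (m (widen_ord (leqnSn n) i)) | i < n]
    + U_(ord_max) *+ m ord_max)%MM = m.
Proof.
apply/mnmP => i; rewrite mnmDE mulmnE mnm1E.
have [<-|ne] := eqVneq ord_max i; first by rewrite mnmwiden_ordmax mul1n.
have lti : (i < n)%N.
  by rewrite ltn_neqAle -ltnS ltn_ord andbT eq_sym -(inj_eq val_inj) in ne *.
have -> : i = widen_ord (leqnSn n) (Ordinal lti) by apply: val_inj.
by rewrite mnmwiden_widen mnmE mul0n addn0.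
Qed.

Lemma muniK : cancel (@muni n R) unmuni.
Proof.
move=> p; rewrite muniE [RHS]mpolyE /unmuni !raddf_sum /= horner_sum.
apply: eq_bigr => m _.
rewrite map_polyZ /= mwidenZ mwidenX map_polyXn hornerZ hornerXn.
by rewrite mpolyXn -scalerAl -mpolyXD mnm_widenD.
Qed.

Lemma muni_widen c : muni (mwiden c) = c%:P :> {poly {mpoly R[n]}}.
Proof.
rewrite [in RHS](mpolyE c) {1}[c]mpolyE [mwiden _]raddf_sum /=.
rewrite [muni _]raddf_sum raddf_sum /=; apply: eq_bigr => m _.
rewrite mwidenZ mwidenX muniZ muniX mnmwiden_ordmax expr0.
rewrite scalerA mul_mpolyC -mul_polyC mulr1.
by congr ((_ *: 'X_[_])%:P); apply/mnmP => i; rewrite mnmE mnmwiden_widen.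
Qed.

Lemma unmuniK : cancel unmuni (@muni n R).
Proof.
elim/poly_ind => [|q c IH].
  by rewrite /unmuni raddf0 horner0 raddf0.
rewrite /unmuni [map_poly _ _]raddfD /=.
rewrite [map_poly _ (q * _)]rmorphM /= map_polyX map_polyC hornerMXaddC.
rewrite muniD muniM /= -/(unmuni q) IH muni_widen muniX; congr (_ * _ + _).
rewrite mnm1E eqxx [X in 'X_[X]](_ : _ = 0%MM) ?mpolyX0 ?scale1r //.
apply/mnmP => i; rewrite mnmE mnm1E mnm0E -val_eqE /= gtn_eqF //.
Qed.
End MPoly.

Lemma mpoly0_const (R : nzRingType) (p : {mpoly R[0]}) : p = (p@_0%MM)%:MP.
Proof.
apply/mpolyP => m; have -> : m = 0%MM by apply/mnmP => -[].
by rewrite mcoeffC eqxx mulr1.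
Qed.

Lemma gcd_domain_mpoly (n : nat) (K : fieldType) : gcd_domain {mpoly K[n]}.
Proof.
elim: n => [|n IH]; last first.
  exact: gcd_domain_iso (@muniK n K) (@unmuniK n K) (gcd_domain_poly IH).
(* Without variables, evaluation at the empty point identifies the ring with [K]. *)
apply: (@gcd_domain_iso _ _ (meval (fun=> 0)) (@mpolyC 0 K))
  (@gcd_domain_field K) => [p|c].
  by rewrite [p]mpoly0_const /= mevalC.
exact: mevalC.
Qed.

(** The inverse is packaged as an algebra morphism so that the lifting construction applies to it
    too. *)
Lemma inverse_lrmorphism (K : fieldType) (A : algType K)
    (f : {lrmorphism A -> A}) :
  bijective f -> exists g : {lrmorphism A -> A}, cancel f g /\ cancel g f.
Proof.
move=> [g fK gK].
have gL : linear g by apply: can2_linear fK gK.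
have gM : monoid_morphism g by apply: can2_monoid_morphism fK gK.
pose L := GRing.isLinear.Build K A A *:%R g gL.
pose M := GRing.isMonoidMorphism.Build A A g gM.
pose G : {lrmorphism A -> A} := HB.pack g L M.
by exists G.
Qed.

(** * Coprime families of polynomials and the grading *)

Section Coprime.
Variables (n : nat) (K : fieldType).
Local Notation A := {mpoly K[n]}.
Implicit Types (u : 'I_n -> A) (h p q w : A).

(** Each step of the induction uses coprimality to strip one factor [u i] from the monomials in
    [u]. *)
Lemma coprime_powers u k w (c : A) : is_gcd u 1 ->
  (forall m : 'X_{1..n}, mdeg m = k -> divides w (c * mmap1 u m)) -> divides w c.
Proof.
move=> cu; elim: k c => [|k IH] c wc.
  by have := wc 0%MM mdeg0; rewrite mmap11 mulr1.
apply: IH => m mk; rewrite -[X in divides _ X]mulr1; apply/cu => i.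
have := wc (m + U_(i))%MM; rewrite mdegD mdeg1 mk addn1 => /(_ erefl).
by rewrite commr_mmap1_M ?mmap1U ?mulrA // => *; apply: mulrC.
Qed.

(** Leading monomials multiply, so that of [h] divides [U_(i) *+ k], which leads because [k] is
    positive. *)
Lemma mlead_divides_XnC h (i j : 'I_n) k (c : K) : (0 < k)%N -> j != i ->
  divides h ('X_i ^+ k - c%:MP) -> mlead h j = 0%N.
Proof.
move=> k_gt0 neji [q e].
have lE : mlead ('X_i ^+ k - c%:MP : A) = (U_(i) *+ k)%MM.
  rewrite mpolyXn mleadDl ?mleadXm // -mpolyCN mleadC lt_neqAle le0m andbT.
  apply/eqP => /(congr1 mdeg); rewrite mdegMn mdeg1 mdeg0 mul1n => k0.
  by rewrite -k0 in k_gt0.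
have nz : 'X_i ^+ k - c%:MP != 0 :> A.
  apply: contraTneq k_gt0 => e0; move: lE; rewrite e0 mlead0 => /(congr1 mdeg).
  by rewrite mdegMn mdeg1 mdeg0 mul1n => <-.
move: nz; rewrite e mulf_eq0 negb_or => /andP[nzq nzh].
move: lE; rewrite e mleadM // => /mnmP/(_ j).
rewrite mnmDE mulmnE mnm1E eq_sym (negPf neji) mul0n => /eqP.
by rewrite addn_eq0 => /andP[_ /eqP].
Qed.

(** In the leading monomial of [h], the first divisibility excludes every variable but [i], and the
    second excludes [i]. The monomial order refines the degree, so [h] is constant. *)
Lemma unit_of_divides_two_XnC h (i j : 'I_n) k l (a b : K) : i != j ->
  (0 < k)%N -> (0 < l)%N -> h != 0 ->
  divides h ('X_i ^+ k - a%:MP) -> divides h ('X_j ^+ l - b%:MP) ->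
  exists2 c, c != 0 & h = c%:MP.
Proof.
move=> neij k0 l0 nzh di dj.
have l_h : mlead h = 0%MM.
  apply/mnmP => t; rewrite mnm0E; have [->|neti] := eqVneq t i.
    exact: mlead_divides_XnC l0 neij dj.
  exact: mlead_divides_XnC k0 neti di.
have hC : h = (h@_0)%:MP by apply: msize1_polyC; rewrite -mlead_deg // l_h mdeg0.
by exists h@_0 => //; apply: contraNneq nzh => h0; rewrite hC h0 mpolyC0.
Qed.

Lemma divides_unit_mul (c : K) p q : c != 0 -> divides p (c%:MP * q) -> divides p q.
Proof.
move=> nzc; move/(divides_mull c^-1%:MP).
by rewrite mulrA -mpolyCM mulVf // mul1r.
Qed.

Lemma coprime_scale u (c : K) : c != 0 -> is_gcd u 1 ->
  is_gcd (fun i => c%:MP * u i) 1.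
Proof.
move=> nzc cu w x; rewrite mulr1; split=> [wu|wx i]; last exact: divides_mulr.
apply: (divides_unit_mul nzc); rewrite -[_ * x]mulr1; apply/cu => i.
by rewrite [_ * x]mulrC -mulrA; apply: wu.
Qed.

(** A common factor of two distinct variables is constant, and a constant gcd can be rescaled to
    1. *)
Lemma coprime_vars : (2 <= n)%N -> is_gcd (fun i : 'I_n => 'X_i : A) 1.
Proof.
move=> n_ge2; pose i0 := Ordinal (ltnW n_ge2); pose i1 := Ordinal n_ge2.
have nzX (i : 'I_n) : 'X_i != 0 :> A by rewrite -msize_poly_eq0 msizeX.
have [|g [u [nzg XE cu]]] :=
  @is_gcd_coprime _ _ (fun i : 'I_n => 'X_i : A) (@gcd_domain_mpoly n K).
  by exists i0.
have gX (i : 'I_n) : divides g ('X_i ^+ 1 - 0%:MP).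
  by rewrite expr1 mpolyC0 subr0 XE; apply: divides_mulr; apply: dividesxx.
have [c nzc gE] :=
  @unit_of_divides_two_XnC g i0 i1 1 1 0 0 isT isT isT nzg (gX _) (gX _).
have := coprime_scale nzc cu; rewrite -gE => cu' w x.
by rewrite -cu'; split=> wX i; move: (wX i); rewrite XE.
Qed.

End Coprime.

(** * Degrees modulo [d], and degrees under substitution *)

Section Graded.
Variables (n : nat) (K : fieldType) (d : nat).
Local Notation A := {mpoly K[n]}.
Implicit Types (u : 'I_n -> A) (p q b : A).

Definition supported (Q : pred nat) p := forall m, m \in msupp p -> Q (mdeg m %% d)%N.

Lemma supportedB Q p q : supported Q p -> supported Q q -> supported Q (p - q).
Proof. by move=> sp sq m /msuppB_le; rewrite mem_cat => /orP[/sp|/sq]. Qed.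

Lemma supportedM0 Q b p : b \in graded d 0 -> supported Q p -> supported Q (b * p).
Proof.
move=> /gradedE b0 sp m /msuppM_le /allpairsP[[m1 m2] /= [/b0 e1 /sp e2 ->]].
by rewrite mdegD -modnDm e1 add0n modn_mod.
Qed.

Lemma supported_split (Q : pred nat) p :
  exists v w, [/\ p = v + w, supported Q v, supported (predC Q) w &
    {subset msupp v <= msupp p}].
Proof.
pose part (P : pred 'X_{1..n}) : A := \sum_(m <- msupp p | P m) p@_m *: 'X_[m].
have partP (P : pred 'X_{1..n}) m : m \in msupp (part P) -> (m \in msupp p) && P m.
  rewrite mcoeff_msupp /part raddf_sum /= big_seq_cond => nz.
  have /hasP[m' m'p /andP[Pm' /eqP <-]] : has (fun m' => P m' && (m' == m)) (msupp p).
    apply: contraNT nz => /hasPn h; rewrite big1 // => m' /andP[/h + Pm'].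
    by rewrite Pm' /= mcoeffZ mcoeffX => /negPf ->; rewrite mulr0.
  by rewrite m'p.
exists (part (fun m => Q (mdeg m %% d)%N)), (part (fun m => ~~ Q (mdeg m %% d)%N)).
split=> [|m /partP/andP[]|m /partP/andP[]|m /partP/andP[]] //.
by rewrite {1}[p]mpolyE (bigID (fun m => Q (mdeg m %% d)%N)).
Qed.

Lemma supported_disjoint Q p : supported Q p -> supported (predC Q) p -> p = 0.
Proof.
move=> sp snp; apply/eqP; rewrite -msupp_eq0; case E: (msupp p) => [//|m s].
have mp : m \in msupp p by rewrite E mem_head.
by move: (snp m mp); rewrite /= sp.
Qed.

Lemma supported_graded j p : supported (pred1 j) p -> p \in graded d j.
Proof. by move=> sp; apply/gradedE => m /sp/eqP. Qed.

(** Let [v i] be the part of [u i] of residue [j], where [j] occurs in [u i0]. The [v i] are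
    proportional to the [u i]; coprimality makes the ratio a polynomial, and degrees make it a
    constant. *)
Lemma coprime_graded u (i0 : 'I_n) : u i0 != 0 -> is_gcd u 1 -> (0 < d)%N ->
  (forall i, u i0 ^+ d.-1 * u i \in graded d 0) ->
  exists2 j, (j < d)%N & forall i, u i \in graded d j.
Proof.
move=> nz0 cu d_gt0 b0; have [m0 m0u] : exists m0, m0 \in msupp (u i0).
  by exists (mlead (u i0)); apply: mlead_supp.
pose j := (mdeg m0 %% d)%N; exists j; first exact: ltn_pmod.
have /fin_all_exists[v /fin_all_exists[w uE]] :=
  fun i => supported_split (pred1 j) (u i).
(* After multiplication by [u i0 ^+ d.-1] the difference of the two sides has only residue [j];
   rewritten with the [w i], it has only residues other than [j]. Hence it vanishes. *)
have vE i : u i * v i0 = u i0 * v i.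
  apply: (@mulfI _ (u i0 ^+ d.-1)); first by rewrite expf_neq0.
  apply/eqP; rewrite -subr_eq0; apply/eqP.
  have [ui0 sv0 sw0 _] := uE i0; have [ui sv sw _] := uE i.
  apply: (@supported_disjoint (pred1 j)).
    by rewrite !mulrA; apply: supportedB; apply: supportedM0.
  have -> : u i0 ^+ d.-1 * (u i * v i0) - u i0 ^+ d.-1 * (u i0 * v i) =
    (u i0 ^+ d.-1 * u i0) * w i - (u i0 ^+ d.-1 * u i) * w i0.
    have -> : w i = u i - v i by rewrite ui addrC addKr.
    have -> : w i0 = u i0 - v i0 by rewrite ui0 addrC addKr.
    by ring.
  by apply: supportedB; apply: supportedM0.
have [_ sv0 sw0 vsub] := uE i0.
have [l v0E] : divides (u i0) (v i0).
  rewrite -[v i0]mulr1; apply/cu => i; rewrite mulrC vE.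
  by rewrite mulrC; apply: divides_mull; apply: dividesxx.
have nzv0 : v i0 != 0.
  apply: contraTneq m0u => v00.
  have [-> _ _ _] := uE i0; rewrite v00 add0r; apply/negP => /sw0.
  by rewrite /= eqxx.
have nzl : l != 0 by apply: contraNneq nzv0 => l0; rewrite v0E l0 mul0r.
(* The monomials of [v i0 = l * u i0] occur in [u i0], so [l] has degree 0. *)
have lC : l = (l@_0)%:MP.
  apply: msize1_polyC.
  have le : (msize (v i0) <= msize (u i0))%N.
    by rewrite -(mlead_deg nzv0); apply: msize_mdeg_lt; apply/vsub/mlead_supp.
  move: le; rewrite v0E msizeM //.
  have : (0 < msize (u i0))%N by rewrite lt0n msize_poly_eq0.
  case: (msize (u i0)) => // s _.
  by rewrite addnS /= -[X in (_ <= X)%N]add1n leq_add2r.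
have nzc : l@_0 != 0 by apply: contraNneq nzl => l0; rewrite lC l0 mpolyC0.
move=> i; have -> : u i = (l@_0)^-1 *: v i.
  have : v i = l * u i.
    by apply: (@mulfI _ (u i0)) => //; rewrite -vE v0E; ring.
  by rewrite {1}lC mul_mpolyC => ->; rewrite scalerA mulVf ?scale1r.
have [_ sv _ _] := uE i.
apply: supported_graded => m /msuppZ_le; exact: sv.
Qed.

(** Residues alone would give only the congruence for [j * j']; the lower bound on degrees supplies
    the inequality. Both conditions add up under products. *)
Definition order_class k p := forall m, m \in msupp p ->
  (k <= mdeg m)%N /\ mdeg m = k %[mod d].

Lemma order_classM k l p q : order_class k p -> order_class l q ->
  order_class (k + l) (p * q).
Proof.
move=> sp sq m /msuppM_le /allpairsP[[m1 m2] /= [/sp[le1 e1] /sq[le2 e2] ->]].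
by rewrite mdegD leq_add // -modnDm e1 e2 modnDm.
Qed.

Lemma order_class1 : order_class 0 (1 : A).
Proof. by move=> m; rewrite msupp1 inE => /eqP ->; rewrite mdeg0. Qed.

Lemma order_classX k p e : order_class k p -> order_class (k * e) (p ^+ e).
Proof.
move=> sp; elim: e => [|e IH]; first by rewrite muln0 expr0; apply: order_class1.
by rewrite mulnS exprS; apply: order_classM.
Qed.

Lemma order_class_mmap1 k u m : (forall i, order_class k (u i)) ->
  order_class (k * mdeg m) (mmap1 u m).
Proof.
move=> su; rewrite /mmap1 mdegE big_distrr /=.
apply: (big_ind2 (fun (p : A) e => order_class e p)) => [|p k1 q k2|i _].
- exact: order_class1.
- exact: order_classM.
exact: order_classX.
Qed.

Lemma order_class_sum (I : eqType) (s : seq I) (F : I -> A) k :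
  (forall i, i \in s -> order_class k (F i)) ->
  order_class k (\sum_(i <- s) F i).
Proof.
move=> sF; rewrite big_seq; apply: big_ind => //.
- by move=> m; rewrite msupp0.
by move=> p q sp sq m /msuppD_le; rewrite mem_cat => /orP[/sp|/sq].
Qed.

(** A monomial [m] of [p] goes into class [l * mdeg m], which is at least [l * k] and congruent to
    it. *)
Lemma order_class_comp k l p (lq : n.-tuple A) : order_class k p ->
  (forall i, order_class l (tnth lq i)) -> order_class (l * k) (p \mPo lq).
Proof.
move=> sp slq; rewrite comp_mpolyEX; apply: order_class_sum => m /sp[le e] m'.
move=> /msuppZ_le; rewrite comp_mpolyX => /(order_class_mmap1 slq)[le' e'].
by rewrite (leq_trans _ le') ?leq_mul2l ?le ?orbT // e' -modnMmr e modnMmr.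
Qed.

End Graded.

(** * Lifting automorphisms of the Veronese subalgebra *)

Section Lifting.
Variables (n : nat) (K : fieldType) (d : nat).
Hypotheses (d_gt0 : (0 < d)%N) (n_ge2 : (2 <= n)%N).
Local Notation A := {mpoly K[n]}.
Local Notation V := (veronese n K d).
Let i0 : 'I_n := Ordinal (ltnW n_ge2).
Let i1 : 'I_n := Ordinal n_ge2.

(** The default 0 is taken when [d] does not divide [mdeg m], hence the hypothesis of
    [vval_monomial]. *)
Definition vmonomial (m : 'X_{1..n}) : V := insubd 0 ('X_[m] : A).

Lemma vval_monomial m : (d %| mdeg m)%N -> vval (vmonomial m) = 'X_[m].
Proof.
move=> dm; rewrite /vmonomial; apply: insubdK; apply/gradedE => m'.
by rewrite msuppX inE => /eqP ->; apply/eqP.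
Qed.

Lemma vval_inj : injective (@vval n K d).
Proof. exact: val_inj. Qed.

Lemma vvalM (p q : V) : vval (p * q) = vval p * vval q.
Proof. exact: (rmorphM (val : V -> A)). Qed.

Lemma vvalX (p : V) k : vval (p ^+ k) = vval p ^+ k.
Proof. exact: (rmorphXn (val : V -> A)). Qed.

Lemma vvalZ c (p : V) : vval (c *: p) = c *: vval p.
Proof. exact: GRing.valZ. Qed.

Lemma vval_sum (I : Type) (r : seq I) (P : pred I) (F : I -> V) :
  vval (\sum_(i <- r | P i) F i) = \sum_(i <- r | P i) vval (F i).
Proof. exact: (raddf_sum (val : V -> A)). Qed.

Lemma vval_prod (I : Type) (r : seq I) (P : pred I) (F : I -> V) :
  vval (\prod_(i <- r | P i) F i) = \prod_(i <- r | P i) vval (F i).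
Proof. exact: (rmorph_prod (val : V -> A)). Qed.

Lemma vmonomialE (p : V) :
  p = \sum_(m <- msupp (vval p)) (vval p)@_m *: vmonomial m.
Proof.
apply: vval_inj; rewrite vval_sum {1}[vval p]mpolyE big_seq [RHS]big_seq.
apply: eq_bigr => m mp; rewrite vvalZ vval_monomial //.
by have /gradedE/(_ m mp) := valP p => /eqP.
Qed.

Lemma lift_monomials (psi : {lrmorphism V -> V}) : bijective psi ->
    (forall c : K, exists e, e ^+ d = c) ->
  exists u : 'I_n -> A, is_gcd u 1 /\
    forall m, (d %| mdeg m)%N -> vval (psi (vmonomial m)) = mmap1 u m.
Proof.
move=> psi_bij roots.
pose e i := (U_(i0) *+ d.-1 + U_(i))%MM.
have de i : (d %| mdeg (e i))%N.
  by rewrite mdegD mdegMn !mdeg1 mul1n addn1 prednK.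
pose b i := vval (psi (vmonomial (e i))).
have nzb : b i0 != 0.
  apply/eqP => b0; have : psi (vmonomial (e i0)) = psi 0.
    by apply: vval_inj; rewrite -/(b i0) b0 rmorph0.
  move/(bij_inj psi_bij)/(congr1 (@vval _ _ _)); rewrite vval_monomial //.
  by move/eqP; rewrite /= -msize_poly_eq0 msizeX.
have [|g [u [nzg bE cu]]] :=
    is_gcd_coprime (@gcd_domain_mpoly n K) (_ : exists i, b i != 0).
  by exists i0.
have nzu : u i0 != 0 by apply: contraNneq nzb => u0; rewrite bE u0 mulr0.
pose Y m := vval (psi (vmonomial m)).
have YE k m : mdeg m = (k * d)%N ->
    Y m * u i0 ^+ mdeg m = (g * u i0) ^+ k * mmap1 u m.
  move=> mk; apply: (@mulfI _ (g ^+ mdeg m)); first by rewrite expf_neq0.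
  have dm : (d %| mdeg m)%N by rewrite mk dvdn_mull.
  (* Both sides are ['X_[m]] times the power [d * mdeg m] of the variable [i0], as [mdeg m = k * d].
     Applying [psi] and cancelling [g ^+ mdeg m] gives [YE]. *)
  have : vmonomial m * vmonomial (e i0) ^+ mdeg m =
      vmonomial (e i0) ^+ k * \prod_i vmonomial (e i) ^+ m i.
    apply: vval_inj; rewrite !vvalM vval_prod !vvalX !vval_monomial //.
    under eq_bigr => i _ do rewrite vvalX vval_monomial // mpolyXD exprMn.
    rewrite big_split /= prodrXr -mdegE -mpolyXE_id -mpolyXn.
    have -> : 'X_[e i0] = 'X_[K, U_(i0)%MM] ^+ d.
      rewrite mpolyXn; congr 'X_[_]; apply/mnmP => t.
      by rewrite mnmDE !mulmnE -mulnSr prednK.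
    rewrite -!exprM [RHS]mulrA -exprD mulrC; congr (_ ^+ _ * _).
    by rewrite mk [(d * k)%N]mulnC -mulSn prednK.
  move/(congr1 psi); rewrite !rmorphM rmorph_prod !rmorphXn.
  move/(congr1 (@vval _ _ _)); rewrite !vvalM vval_prod !vvalX -/(Y m) -/(b i0).
  under eq_bigr => i _ do rewrite rmorphXn vvalX -/(b i) bE exprMn.
  rewrite big_split /= prodrXr -mdegE -/(mmap1 u m) bE exprMn => E.
  by rewrite mulrCA E; ring.
(* By [YE] with [k = 1], [u i0 ^+ d] divides [g * u i0] times every monomial of degree [d] in
   [u]. *)
have [h hE] : divides (u i0 ^+ d) (g * u i0).
  apply: (coprime_powers (k := d) cu) => m md.
  by exists (Y m); rewrite -[in RHS]md (YE 1%N) ?mul1n ?expr1.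
have nzh : h != 0.
  by apply: contraNneq nzb => h0; rewrite bE hE h0 mul0r.
have {}YE k m : mdeg m = (k * d)%N -> Y m = h ^+ k * mmap1 u m.
  move=> mk; apply: (@mulIf _ (u i0 ^+ mdeg m)); first by rewrite expf_neq0.
  by rewrite (YE k) // hE exprMn -exprM mk [(d * k)%N]mulnC mulrAC.
(* Write ['X_i ^+ d] as [psi s] and expand [s]: monomials of positive degree have images divisible
   by [h], and the trivial one contributes the constant. *)
have hX (i : 'I_n) : exists c : K, divides h ('X_i ^+ d - c%:MP).
  have dU : (d %| mdeg (U_(i) *+ d)%MM)%N by rewrite mdegMn mdeg1 mul1n.
  have [psi' _ psiK] := psi_bij.
  set s := psi' (vmonomial (U_(i) *+ d)%MM).
  have -> : 'X_i ^+ d = vval (psi s) by rewrite psiK vval_monomial // mpolyXn.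
  rewrite [s]vmonomialE [psi _]raddf_sum vval_sum big_seq.
  apply: (big_ind (fun x : A => exists c : K, divides h (x - c%:MP))) =>
    [|p q [c1 h1] [c2 h2]|m ms].
  - by exists 0; rewrite mpolyC0 subr0; apply: divides0.
  - by exists (c1 + c2); rewrite mpolyCD opprD addrACA; apply: dividesD.
  rewrite /= linearZ vvalZ -/(Y m).
  have /gradedE/(_ m ms)/eqP/dvdnP[k mk] := valP s.
  rewrite (YE k) //; case: k mk => [|k] mk.
    exists (vval s)@_m; move: mk => /eqP; rewrite mul0n mdeg_eq0 => /eqP ->.
    by rewrite mmap11 mulr1 expr0 -mul_mpolyC mulr1 subrr; apply: divides0.
  exists 0; rewrite mpolyC0 subr0 -mul_mpolyC; apply: divides_mull.
  by rewrite exprS -mulrA; apply: divides_mulr; apply: dividesxx.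
have [[a ha] [a' ha']] := (hX i0, hX i1).
have [c nzc hC] :=
  unit_of_divides_two_XnC (isT : i0 != i1) d_gt0 d_gt0 nzh ha ha'.
have [r rE] := roots c.
have nzr : r != 0 by apply: contraNneq nzc => r0; rewrite -rE r0 expr0n gtn_eqF.
(* A monomial of degree [k * d] in [r * u] gains the factor [r ^+ (k * d)], which is [h ^+ k]. *)
exists (fun i => r%:MP * u i); split; first exact: coprime_scale.
move=> m /dvdnP[k mk]; rewrite -/(Y m) (YE k) // hC -rE.
rewrite /mmap1; under [RHS]eq_bigr do rewrite exprMn.
by rewrite big_split /= prodrXr -mdegE mk mulnC exprM !rmorphXn.
Qed.

(** The common residue [j] stays free; only comparison with a lift of the inverse identifies it as
    1. *)
Definition lift (psi : {lrmorphism V -> V}) (lq : n.-tuple A) :=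
  [/\ is_gcd (tnth lq) 1,
      exists2 j, (j < d)%N & forall i, tnth lq i \in graded d j
    & forall p : V, vval (psi p) = vval p \mPo lq].

Lemma lift_exists (psi : {lrmorphism V -> V}) : bijective psi ->
  (forall c : K, exists e, e ^+ d = c) -> exists lq, lift psi lq.
Proof.
move=> psi_bij roots; have [u [cu uE]] := lift_monomials psi_bij roots.
pose lq := [tuple u i | i < n]; exists lq.
have tE i : tnth lq i = u i by rewrite tnth_mktuple.
have psiE (p : V) : vval (psi p) = vval p \mPo lq.
  rewrite {1}[p]vmonomialE [psi _]raddf_sum vval_sum comp_mpolyEX.
  rewrite big_seq [RHS]big_seq; apply: eq_bigr => m mp.
  have dm : (d %| mdeg m)%N by have /gradedE/(_ m mp)/eqP := valP p.
  rewrite /= linearZ vvalZ uE // comp_mpolyX; congr (_ *: _).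
  by apply: eq_bigr => i _; rewrite tE.
split=> //.
  by move=> w c; rewrite -cu; split=> wu i; have := wu i; rewrite tE.
(* Otherwise [psi] would kill the monomial of [U_(i0) *+ d], against injectivity. *)
have nzu : u i0 != 0.
  apply/eqP => u0; have := uE (U_(i0) *+ d)%MM.
  rewrite mdegMn mdeg1 mul1n => /(_ (dvdnn d)).
  have -> : mmap1 u (U_(i0) *+ d) = 0.
    rewrite /mmap1 (bigD1 i0) //= mulmnE mnm1E eqxx mul1n u0.
    by rewrite expr0n gtn_eqF ?mul0r.
  have -> : 0 = vval (psi 0) by rewrite rmorph0.
  move/vval_inj/(bij_inj psi_bij)/(congr1 (@vval _ _ _)).
  rewrite vval_monomial ?mdegMn ?mdeg1 ?mul1n // => /eqP.
  by rewrite /= -msize_poly_eq0 msizeX.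
(* [u i0 ^+ d.-1 * u i] is a value of [psi], hence has residue 0. *)
have [i|j ltj uj] := coprime_graded nzu cu d_gt0.
  have := uE (U_(i0) *+ d.-1 + U_(i))%MM.
  rewrite mdegD mdegMn !mdeg1 mul1n addn1 prednK // => /(_ (dvdnn d)).
  have -> : mmap1 u (U_(i0) *+ d.-1 + U_(i)) = u i0 ^+ d.-1 * u i.
    rewrite commr_mmap1_M => [|*]; last exact: mulrC.
    rewrite mmap1U; congr (_ * _).
    rewrite /mmap1 (bigD1 i0) //= mulmnE mnm1E eqxx mul1n.
    rewrite big1 ?mulr1 // => t ne.
    by rewrite mulmnE mnm1E eq_sym (negPf ne) mul0n expr0.
  by move=> <-; apply: valP.
by exists j => // i; rewrite tE.
Qed.

(** The hypotheses give [w i * 'X_i0 = 'X_i * w i0], so coprimality of the variables makes ['X_i0]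
    divide [w i0]. The quotient [l] satisfies [l ^+ d = 1], so its degree is 0. *)
Lemma scaled_vars (w : 'I_n -> A) :
  (forall i, w i0 ^+ d.-1 * w i = 'X_i0 ^+ d.-1 * 'X_i) ->
  exists2 c : K, c != 0 & forall i, w i = c *: 'X_i.
Proof.
move=> wX; have nzX : 'X_i0 != 0 :> A by rewrite -msize_poly_eq0 msizeX.
have w0X : w i0 ^+ d = 'X_i0 ^+ d by rewrite -(prednK d_gt0) !exprSr wX.
have nzw : w i0 != 0.
  apply: contraNneq nzX => w0; move/eqP: w0X.
  by rewrite w0 expr0n gtn_eqF // eq_sym expf_eq0 d_gt0.
have wXC i : w i * 'X_i0 = 'X_i * w i0.
  apply: (@mulfI _ ('X_i0 ^+ d.-1)); first by rewrite expf_neq0.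
  rewrite [RHS]mulrA -wX [w i * _]mulrC mulrA -exprSr prednK // -w0X.
  by rewrite -[in LHS](prednK d_gt0) exprSr mulrAC.
have [l lE] : divides 'X_i0 (w i0).
  rewrite -[w i0]mulr1.
  apply: (proj1 (@coprime_vars n K n_ge2 'X_i0 (w i0))) => i.
  by exists (w i); rewrite wXC mulrC.
have ld : l ^+ d = 1.
  apply: (@mulIf _ ('X_i0 ^+ d)); first by rewrite expf_neq0.
  by rewrite mul1r -exprMn -lE.
have nzl : l != 0 by apply: contraNneq nzw => l0; rewrite lE l0 mul0r.
have lC : l = (l@_0)%:MP.
  apply: msize1_polyC; rewrite -mlead_deg // ltnS leqn0.
  have := congr1 (@mlead _ _) ld; rewrite mleadX // mlead1 => /(congr1 mdeg)/eqP.
  by rewrite mdegMn mdeg0 muln_eq0 (gtn_eqF d_gt0) orbF.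
exists l@_0; first by apply: contraNneq nzl => l0; rewrite lC l0 mpolyC0.
move=> i; rewrite -mul_mpolyC -lC; apply: (@mulIf _ 'X_i0) => //.
by rewrite wXC lE; ring.
Qed.

(** The composite substitution fixes the monomials to which [scaled_vars] applies, as they lie in
    the Veronese subalgebra. *)
Lemma lift_inverse (psi psi' : {lrmorphism V -> V}) lq lq' :
  lift psi lq -> lift psi' lq' -> cancel psi psi' ->
  exists2 c : K, c != 0 & forall i, ('X_i \mPo lq) \mPo lq' = c *: 'X_i.
Proof.
move=> [_ _ psiE] [_ _ psiE'] psiK; apply: scaled_vars => i.
have dm : (d %| mdeg (U_(i0) *+ d.-1 + U_(i))%MM)%N.
  by rewrite mdegD mdegMn !mdeg1 mul1n addn1 prednK.
rewrite -!rmorphXn -!rmorphM /= mpolyXn -mpolyXD -(vval_monomial dm).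
by rewrite -psiE -psiE' psiK.
Qed.

Lemma comp_mpoly_scale (c : K) (p : A) (lq lq' : n.-tuple A) :
  (forall i, ('X_i \mPo lq) \mPo lq' = c *: 'X_i) ->
  (p \mPo lq) \mPo lq' = p \mPo [tuple c *: 'X_i | i < n].
Proof.
move=> lqX; rewrite [p]mpolyE (raddf_sum (comp_mpoly lq)).
rewrite (raddf_sum (comp_mpoly lq')) (raddf_sum (comp_mpoly _)).
apply: eq_bigr => m _ /=.
rewrite !linearZ /= mpolyXE_id !rmorph_prod /=; congr (_ *: _).
apply: eq_bigr => i _.
by rewrite !rmorphXn /= lqX [in RHS]comp_mpolyXU -tnth_nth tnth_mktuple.
Qed.

Lemma comp_mpoly_scaleK (c : K) : c != 0 ->
  cancel (comp_mpoly [tuple c *: ('X_i : A) | i < n])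
         (comp_mpoly [tuple c^-1 *: ('X_i : A) | i < n]).
Proof.
move=> nzc p; rewrite (@comp_mpoly_scale 1) => [|i].
  rewrite -[RHS]comp_mpoly_id; congr (_ \mPo _).
  by apply: eq_from_tnth => i; rewrite !tnth_mktuple scale1r.
rewrite comp_mpolyXU -tnth_nth tnth_mktuple linearZ /=.
by rewrite comp_mpolyXU -tnth_nth tnth_mktuple scalerA mulfV.
Qed.

(** One composite gives a left inverse, the other surjectivity. *)
Lemma bijective_of_cancel_scalings (lq lq' : n.-tuple A) (c c' : K) :
  c != 0 -> c' != 0 ->
  (forall i, ('X_i \mPo lq) \mPo lq' = c *: 'X_i) ->
  (forall i, ('X_i \mPo lq') \mPo lq = c' *: 'X_i) -> bijective (comp_mpoly lq).
Proof.
move=> nzc nzc' lqX lqX'.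
pose s (a : K) := comp_mpoly [tuple a *: ('X_i : A) | i < n].
have lK : cancel (comp_mpoly lq) (s c^-1 \o comp_mpoly lq').
  by move=> p /=; rewrite (comp_mpoly_scale p lqX); apply: comp_mpoly_scaleK.
exists (s c^-1 \o comp_mpoly lq') => // q.
(* Undoing the scaling by [c'] first exhibits [q] as a value of [comp_mpoly lq], on which the left
   inverse is also a right inverse. *)
have qE : q = (s c'^-1 q \mPo lq') \mPo lq.
  rewrite (comp_mpoly_scale _ lqX'); have := @comp_mpoly_scaleK c'^-1.
  by rewrite invr_eq0 invrK => /(_ nzc' q).
by rewrite {1}qE lK -qE.
Qed.

(** A degree with residue [j < d] is at least [j]. *)
Lemma graded_order_class j (p : A) :
  (j < d)%N -> p \in graded d j -> order_class d j p.
Proof.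
move=> ltj /gradedE pj m mp; have e := pj m mp.
by split; [rewrite -e leq_mod | rewrite e modn_small].
Qed.

Lemma lift_d_graded (psi psi' : {lrmorphism V -> V}) lq lq' : (2 <= d)%N ->
  lift psi lq -> lift psi' lq' -> cancel psi psi' ->
  forall i, tnth lq i \in graded d 1.
Proof.
move=> d_ge2 lpsi lpsi' psiK; have [c nzc cE] := lift_inverse lpsi lpsi' psiK.
have [_ [j ltj lqj] _] := lpsi; have [_ [j' ltj' lqj'] _] := lpsi'.
have := order_class_comp (graded_order_class ltj (lqj i0))
  (fun i => graded_order_class ltj' (lqj' i)).
have := cE i0; rewrite comp_mpolyXU -tnth_nth => -> /(_ U_(i0)%MM).
rewrite mcoeff_msupp mcoeffZ mcoeffX eqxx mulr1 => /(_ nzc).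
rewrite mdeg1 => -[le1 e1].
(* If the product were 0, then 1 would be 0 modulo [d], which [d >= 2] excludes. *)
have : (0 < j' * j)%N.
  by rewrite lt0n; apply: contra_eqN e1 => /eqP ->; rewrite mod0n modn_small.
rewrite muln_gt0 => /andP[j'_gt0 j_gt0] i.
have -> // : 1%N = j; apply/eqP; rewrite eqn_leq j_gt0.
by rewrite (leq_trans _ le1) // leq_pmull.
Qed.

End Lifting.

Theorem corollary4 (d n : nat) (K : fieldType) (d_ge2 : (2 <= d)%N)
    (n_ge2 : (2 <= n)%N) (K_roots : closed_under_roots d K)
    (psi : {lrmorphism veronese n K d -> veronese n K d})
    (psi_aut : is_automorphism psi) :
  exists phi : {lrmorphism {mpoly K[n]} -> {mpoly K[n]}},
    [/\ is_automorphism phi,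
        d_graded d phi
      & forall p : veronese n K d, vval (psi p) = phi (vval p)].
Proof.
have d_gt0 : (0 < d)%N := ltnW d_ge2.
have roots (c : K) : exists e, e ^+ d = c.
  have [rs rsE] := K_roots c; have sz : size ('X^d - c%:P : {poly K}) = d.+1.
    by apply: size_XnsubC.
  (* The degree [d > 0] rules out an empty list of roots; its head is a [d]-th root of [c]. *)
  case: rs rsE => [|r rs] rsE.
    by move: sz; rewrite rsE big_nil size_poly1 => -[d0]; rewrite -d0 in d_gt0.
  exists r; have := congr1 (horner^~ r) rsE.
  rewrite big_cons !hornerE subrr mul0r => /eqP.
  by rewrite subr_eq0 => /eqP.
have [psi' [psiK psiK']] := inverse_lrmorphism psi_aut.
have psi_aut' : bijective psi' by exists psi.
have [lq lpsi] := lift_exists d_gt0 n_ge2 psi_aut roots.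
have [lq' lpsi'] := lift_exists d_gt0 n_ge2 psi_aut' roots.
have [c nzc cE] := lift_inverse d_gt0 n_ge2 lpsi lpsi' psiK.
have [c' nzc' cE'] := lift_inverse d_gt0 n_ge2 lpsi' lpsi psiK'.
exists (comp_mpoly lq : {lrmorphism _ -> _}); split.
- exact: bijective_of_cancel_scalings nzc nzc' cE cE'.
- move=> i; rewrite /= comp_mpolyXU -tnth_nth.
  exact: (lift_d_graded d_gt0 n_ge2 d_ge2 lpsi lpsi' psiK).
by have [] := lpsi.
Qed.
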